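(* For every even integer $k \geq 2$, there exists a Sperner $k$-partition system on a set of $2k+1$ elements with exactly $2k$ partitions.
   Context: A $k$-partition of a finite set $X$ is a collection of exactly $k$ pairwise disjoint non-empty subsets of $X$ (called classes) whose union is $X$. A Sperner $k$-partition system on $X$ is a set $\mathcal{P}$ of $k$-partitions of $X$ such that for any two distinct partitions $P, Q \in \mathcal{P}$, no class of $P$ is a subset of (in particular, equal to) a class of $Q$. *)

(* Defs.v *)
From mathcomp Require Import all_boot.

Set Implicit Arguments.
Unset Strict Implicit.
Unset Printing Implicit Defensive.

Definition kpartition (T : finType) (k : nat) (X : {set T})
    (P : {set {set T}}) : bool :=
  partition P X && (#|P| == k).

(* Classes of one and the same partition are not compared with each other. *)
Definition sperner_kpartition_system (T : finType) (k : nat) (X : {set T})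
    (S : {set {set {set T}}}) : Prop :=
  (forall P, P \in S -> kpartition k X P) /\
  (forall P Q, P \in S -> Q \in S -> P <> Q ->
     forall A B, A \in P -> B \in Q -> ~~ (A \subset B)).

(* Main.v *)
Require Import Defs.
From mathcomp Require Import all_boot.
From mathcomp Require Import ssralg zmodp zify.

Set Implicit Arguments.
Unset Strict Implicit.
Unset Printing Implicit Defensive.

(** Once there are two partitions no class is a singleton, so on 2k+1 points
    each partition consists of one triple and k-1 pairs. Such a partition is the
    same thing as an involution with exactly three fixed points: the fixed points
    form the triple, the 2-cycles are the pairs. The Sperner condition says that
    no pair occurs twice, that no pair lies in a triple, and that the triples are
    distinct; [triple_pair_system] states this for a family of involutions, and
    [sperner_of_system] and [sperner_transfer] turn such a family into the
    required system on any set of the right size.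

    Systems are enlarged by filling holes. The 2k+1 points are 2k finite ones,
    which also index the partitions, and a point at infinity. Suppose that the
    finite points are U * Y and that every z in U * Y comes with a perfect
    matching of the points outside the hole (fibre over U) of z, such that
    matched points lie in different holes and no edge belongs to two matchings.
    This is a [frame]. Given a system on Y plus infinity, copy it inside each
    hole plus infinity, with infinity shared by all copies, and complete the
    partition with index z = (u, i) of the copy in hole u by the matching of z.
    The result is a system on U * Y plus infinity ([system_fill]).

    Two frames suffice, and either can be blown up to holes of a larger size
    ([frame_weight]). For U of odd order n, take holes of size 1 and let the
    matching of z be the reflection x |-> 2z - x of Z_n. For U of order 4, take
    holes of size 2, namely the cosets of {0,4} in Z_8, and develop the starter
    {1,2}, {3,6}, {5,7} cyclically. They multiply k by an odd number and by 4.
    Together with explicit systems for k = 2 and k = 4 this reaches every even k: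
    if k/2 or k/4 is odd, start from 2 or 4; otherwise k/4 is even and induction
    applies ([exists_system]). *)

(** * Partitions from involutions *)

Section Systems.
Variables V I : finType.

Definition fixpoints (f : V -> V) : {set V} := [set x | f x == x].

(** The last three conditions exclude, in this order, a pair shared by two
    partitions, a pair inside the triple of another partition, and two equal
    triples. *)
Definition triple_pair_system (p : I -> V -> V) : Prop :=
  [/\ forall i, involutive (p i),
      forall i, #|fixpoints (p i)| = 3,
      forall i j x, i != j -> p i x = p j x -> p i x = x,
      forall i j x, i != j -> x \in fixpoints (p i) ->
        p j x \in fixpoints (p i) -> p j x = x
    & forall i j, i != j ->
        exists2 x, x \in fixpoints (p i) & x \notin fixpoints (p j)].

Variable p : I -> V -> V.
Hypothesis sys_p : triple_pair_system p.

Definition cls i x := if p i x == x then fixpoints (p i) else [set x; p i x].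
Definition classes i : {set {set V}} := [set cls i x | x : V].

Lemma mem_cls i x : x \in cls i x.
Proof. by rewrite /cls; case: ifP => h; rewrite ?inE ?h ?eqxx. Qed.

Lemma cls_eq i x y : y \in cls i x -> cls i y = cls i x.
Proof.
have [inv _ _ _ _] := sys_p.
rewrite /cls; case: (boolP (p i x == x)) => [fx | nfx].
  by rewrite inE => ->.
rewrite !inE => /orP [] /eqP ->; first by rewrite (negPf nfx).
by rewrite inv eq_sym (negPf nfx) setUC.
Qed.

Lemma classes_partition i : partition (classes i) [set: V].
Proof.
apply/and3P; split.
- apply/eqP/setP => x; rewrite inE; apply/bigcupP; exists (cls i x).
    exact: imset_f.
  exact: mem_cls.
- apply/trivIsetP => A B /imsetP [x _ ->] /imsetP [y _ ->].
  apply: contraR => /pred0Pn [z /andP [/= zx zy]].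
  by rewrite -(cls_eq zx) -(cls_eq zy).
- apply/imsetP => -[x _ e]; have := mem_cls i x.
  by rewrite -e inE.
Qed.

(** All classes have two elements except the triple, which contributes one
    more. *)
Lemma card_classes i : #|V| = 2 * #|classes i| + 1.
Proof.
have [inv fix3 _ _ _] := sys_p.
have cardE A : A \in classes i -> #|A| = 2 + (A == fixpoints (p i)).
  case/imsetP => x _ ->; rewrite /cls; case: (boolP (p i x == x)) => [fx | nfx].
    by rewrite eqxx fix3.
  rewrite cards2 eq_sym nfx; case: eqP => // e.
  by move/negP: nfx; case; move/setP/(_ x): e; rewrite !inE eqxx.
rewrite -cardsT (card_partition (classes_partition i)) (eq_bigr _ cardE).
rewrite big_split /= sum_nat_const mulnC; congr (_ + _).
have Fi : fixpoints (p i) \in classes i.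
  have /card_gt0P [x fx] : 0 < #|fixpoints (p i)| by rewrite fix3.
  by apply/imsetP; exists x => //; rewrite /cls; rewrite inE in fx; rewrite fx.
rewrite (bigD1 _ Fi) /= eqxx big1 // => A /andP [_ /negPf ->] //.
Qed.

Lemma classes_sperner i j A B :
  i != j -> A \in classes i -> B \in classes j -> ~~ (A \subset B).
Proof.
have [inv fix3 pairs pair_triple triples] := sys_p.
move=> ij /imsetP [x _ ->] /imsetP [y _ ->]; apply/negP; rewrite /cls.
have ji : j != i by rewrite eq_sym.
case: (boolP (p i x == x)) => [fx | /eqP nfx].
  case: (boolP (p j y == y)) => [fy | nfy] sub.
    by have [z zi /negP] := triples _ _ ij; case; apply: (subsetP sub).
  by have := subset_leq_card sub; rewrite fix3 cards2; case: (y != _).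
rewrite subUset !sub1set.
case: (boolP (p j y == y)) => [fy /andP [xj pxj] | nfy].
  apply/nfx/(pair_triple j i) => //; by rewrite inE.
have no : p j x <> p i x by move/esym => e; apply/nfx/(pairs i j).
rewrite !inE => /andP [] /orP [] /eqP xy /orP [] /eqP e.
- by apply: nfx; rewrite e xy.
- by apply: no; rewrite e xy.
- by apply: no; rewrite e xy inv.
- by apply: nfx; rewrite e xy.
Qed.

Lemma sperner_of_system k : #|V| = 2 * k + 1 ->
  exists S : {set {set {set V}}},
    sperner_kpartition_system k [set: V] S /\ #|S| = #|I|.
Proof.
have [_ fix3 _ _ _] := sys_p.
move=> cardV; exists [set classes i | i : I]; split; first split.
- move=> P /imsetP [i _ ->]; rewrite /kpartition classes_partition /=.
  move: (card_classes i); rewrite cardV => /eqP.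
  by rewrite eqn_add2r eqn_mul2l /= eq_sym.
- move=> P Q /imsetP [i _ ->] /imsetP [j _ ->] PQ A B.
  by apply: classes_sperner; apply: contra_notN PQ => /eqP ->.
- apply: card_imset => i j eij; apply/eqP/idPn => ij.
  have /card_gt0P [x _] : 0 < #|fixpoints (p i)| by rewrite fix3.
  have xi : cls i x \in classes i by apply: imset_f.
  have xj : cls i x \in classes j by rewrite -eij.
  by have := classes_sperner ij xi xj; rewrite subxx.
Qed.

End Systems.

(** * Renaming the points *)

Lemma partition_imset (V T : finType) (f : V -> T) (P : {set {set V}}) D :
  injective f -> partition P D ->
  partition [set f @: A | A : {set V} in P] (f @: D).
Proof.
move=> fI /and3P [/eqP cov triv no0]; apply/and3P; split.
- rewrite -cov; apply/eqP/setP => t; apply/bigcupP/imsetP.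
    case=> _ /imsetP [A AP ->] /imsetP [x xA ->].
    by exists x => //; apply/bigcupP; exists A.
  case=> x /bigcupP [A AP xA] ->; exists (f @: A); exact: imset_f.
- apply/trivIsetP => _ _ /imsetP [A AP ->] /imsetP [B BP ->] AB.
  rewrite imset_disjoint //.
  by apply: (trivIsetP triv) => //; apply: contraNneq AB => ->.
- apply/imsetP => -[A AP /esym /eqP]; rewrite imset_eq0 => /eqP A0.
  by rewrite -A0 AP in no0.
Qed.

Lemma sperner_transfer (V T : finType) (X : {set T}) k S :
  #|V| = #|X| -> sperner_kpartition_system k [set: V] S ->
  exists S' : {set {set {set T}}},
    sperner_kpartition_system k X S' /\ #|S'| = #|S|.
Proof.
move=> cVX [part sper].
pose f (v : V) : T := enum_val (cast_ord cVX (enum_rank v)).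
have fI : injective f by move=> v w /enum_val_inj /cast_ord_inj /enum_rank_inj.
have fX : f @: [set: V] = X.
  apply/eqP; rewrite eqEcard card_imset // cardsT cVX leqnn andbT.
  by apply/subsetP => _ /imsetP [v _ ->]; apply: enum_valP.
have fsI : injective (fun A : {set V} => f @: A) by apply: imset_inj.
pose F (P : {set {set V}}) := [set f @: A | A : {set V} in P].
have FI : injective F by apply: imset_inj.
exists [set F P | P in S]; split; last by rewrite card_imset.
split.
- move=> _ /imsetP [P PS ->]; have /andP [pP cP] := part _ PS.
  by rewrite /kpartition card_imset // cP -fX partition_imset.
- move=> _ _ /imsetP [P PS ->] /imsetP [Q QS ->] PQ.
  move=> _ _ /imsetP [A AP ->] /imsetP [B BQ ->].
  have nPQ : P <> Q by move=> e; apply: PQ; rewrite e.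
  have := sper _ _ PS QS nPQ _ _ AP BQ; apply: contra => /subsetP sub.
  by apply/subsetP => x /(imset_f f) /sub; rewrite mem_imset.
Qed.

(** * Frames and the filling of holes *)

(** [m z] is the matching with index z, and the first coordinate of a point
    names its hole. Nothing is asked of [m z] on the hole of z. The last clause
    says that an edge determines the matching that contains it. *)
Definition frame (U Y : finType) (m : U * Y -> U * Y -> U * Y) : Prop :=
  forall z x, x.1 != z.1 ->
  [/\ (m z x).1 != z.1, (m z x).1 != x.1, m z (m z x) = x
    & forall z', x.1 != z'.1 -> m z x = m z' x -> z = z'].

Section Filling.
Variables (U Y : finType) (m : U * Y -> U * Y -> U * Y) (p : Y -> option Y -> option Y).
Hypotheses (frame_m : frame m) (sys_p : triple_pair_system p).

(** The hole u together with the point at infinity; infinity belongs to all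
    these sets. *)
Definition fibre (u : U) : option Y -> option (U * Y) := omap (pair u).

Definition fill (z : U * Y) (x : option (U * Y)) : option (U * Y) :=
  match x with
  | None => fibre z.1 (p z.2 None)
  | Some y => if y.1 == z.1 then fibre z.1 (p z.2 (Some y.2)) else Some (m z y)
  end.

Variant fibre_spec (u : U) : option (U * Y) -> Type :=
  | InFibre v : fibre_spec u (fibre u v)
  | OffFibre x of x.1 != u : fibre_spec u (Some x).

Lemma fibreP u x : fibre_spec u x.
Proof.
case: x => [[u' y] | ]; last exact: (InFibre u None).
have [-> | ne] := eqVneq u' u; [exact: (InFibre u (Some y)) | exact: OffFibre].
Qed.

Lemma fibre_inj u : injective (fibre u).
Proof. by move=> [v|] [w|] //= [->]. Qed.

Lemma fill_fibre u i v : fill (u, i) (fibre u v) = fibre u (p i v).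
Proof. by case: v => //= v; rewrite eqxx. Qed.

Lemma fill_off z x : x.1 != z.1 -> fill z (Some x) = Some (m z x).
Proof. by rewrite /= => /negPf ->. Qed.

Lemma fibre_off u v x : x.1 != u -> fibre u v <> Some x.
Proof. by case: v => //= v; case: x => u' y /= /eqP ne [/esym]. Qed.

(** The matching of z moves every point that it covers, so triples come only
    from the small systems. *)
Lemma fixpoints_fill u i :
  fixpoints (fill (u, i)) = fibre u @: fixpoints (p i).
Proof.
apply/setP => x; rewrite inE; case: (fibreP u x) => [v | {}x ne].
  by rewrite fill_fibre (inj_eq (@fibre_inj u)) mem_imset ?inE //; apply: fibre_inj.
have [_ mx _ _] := frame_m (z := (u, i)) ne.
rewrite fill_off //; apply/eqP/imsetP.
  by case=> e; rewrite e eqxx in mx.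
by case=> v _ /esym /(fibre_off ne).
Qed.

(** For two indices in the same hole, the points of that hole and infinity are
    handled by the small system, the other points by the frame. For indices in
    different holes u and u', a pair or triple of the first copied system stays
    in hole u plus infinity, where the second partition sends every finite point
    of hole u out of that hole, and sends infinity into hole u' or to itself. *)
Lemma system_fill : triple_pair_system fill.
Proof.
have [inv fix3 pairs pair_triple triples] := sys_p; split.
- move=> [u i] x; case: (fibreP u x) => [v | {}x ne].
    by rewrite !fill_fibre inv.
  have [mz mx mm _] := frame_m (z := (u, i)) ne.
  by rewrite !fill_off // mm.
- by move=> [u i]; rewrite fixpoints_fill card_imset //; apply: fibre_inj.
- move=> [u i] [u' j] x zz'; case: (fibreP u x) => [v | {}x ne].
    have [eu | nu] := eqVneq u u'.
      move: zz'; rewrite -eu !fill_fibre => zz' /fibre_inj e.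
      by rewrite (pairs i j) //; apply: contraNneq zz' => ->.
    case: v => [v | ]; last first.
      by rewrite /fill /=; case: (p i None) (p j None) => [a|] [b|] //= [/eqP]; rewrite (negPf nu).
    rewrite fill_fibre (@fill_off (u', j) (u, v) nu) => e.
    have [_ mx _ _] := frame_m (z := (u', j)) (x := (u, v)) nu.
    by case: (fibre_off mx e).
  rewrite fill_off //; have [_ mx _ minj] := frame_m (z := (u, i)) ne.
  have [eu | nu] := eqVneq x.1 u'.
    move=> e; rewrite eu in mx.
    have := fill_fibre u' j (Some x.2); rewrite /= -eu -surjective_pairing.
    by move=> e'; case: (fibre_off (v := p j (Some x.2)) mx); rewrite e -eu -e'.
  by rewrite fill_off // => -[e]; case/eqP: zz'; apply: minj.
- move=> [u i] [u' j] x zz'; rewrite !fixpoints_fill => /imsetP [v fv ->].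
  have [eu | nu] := eqVneq u u'.
    move: zz'; rewrite -eu fill_fibre => zz'.
    rewrite mem_imset; last exact: fibre_inj.
    by move=> fp; rewrite (pair_triple i j) //; apply: contraNneq zz' => ->.
  case: v fv => [v | ] _.
    rewrite (@fill_off (u', j) (u, v) nu) => /imsetP [w _ /esym e].
    have [_ mx _ _] := frame_m (z := (u', j)) (x := (u, v)) nu.
    by case: (fibre_off mx e).
  case/imsetP => w _; rewrite /fill /=.
  by case: (p j None) w => [a|] [b|] //= [/esym/eqP]; rewrite (negPf nu).
- move=> [u i] [u' j] zz'; rewrite !fixpoints_fill.
  have [eu | nu] := eqVneq u u'.
    have ij : i != j by move: zz'; rewrite eu; apply: contraNneq => ->.
    have [x xi xj] := triples _ _ ij.
    exists (fibre u x); first exact: imset_f.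
    by rewrite -eu mem_imset //; apply: fibre_inj.
  (* A finite point of the triple is needed, because infinity may also be fixed
     by the other partition; of three fixed points at least two are finite. *)
  have : 0 < #|fixpoints (p i) :\ None|.
    by move: (cardsD1 None (fixpoints (p i))); rewrite fix3; case: #|_| => //; case: (_ \in _).
  case/card_gt0P => -[v | ]; rewrite !inE //= => fv.
  exists (fibre u (Some v)); first by apply: imset_f; rewrite inE.
  apply/imsetP => -[w _ /esym e].
  exact: (fibre_off (x := (u, v)) nu e).
Qed.

End Filling.

Lemma card_bij (A B : finType) :
  #|A| = #|B| -> exists (f : A -> B) (g : B -> A), cancel f g /\ cancel g f.
Proof.
move=> e; exists (fun a => enum_val (cast_ord e (enum_rank a))).
exists (fun b => enum_val (cast_ord (esym e) (enum_rank b))).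
by split=> x; rewrite enum_valK ?cast_ordK ?cast_ordKV enum_rankK.
Qed.

(** * Two frames *)

(** Replace each point by w copies indexed by Z_w. The matching with index
    (z, g) joins (x, h) to (m z x, g - h): for a fixed edge between two points
    with coordinates h and h', the sum h + h' recovers g. *)
Lemma frame_weight (U Y W : finType) (m : U * Y -> U * Y -> U * Y) w :
  frame m -> 0 < w -> #|W| = #|Y| * w ->
  exists m' : U * W -> U * W -> U * W, frame m'.
Proof.
move=> fm; case: w => // w _ cW.
have [|f [g [fK gK]]] := @card_bij W (Y * 'I_w.+1)%type.
  by rewrite card_prod card_ord.
pose lo (z : U * W) := (z.1, (f z.2).1).
pose m' (z x : U * W) := let y := m (lo z) (lo x) in
  (y.1, g (y.2, (f z.2).2 - (f x.2).2)%R).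
have loE z x : lo (m' z x) = m (lo z) (lo x).
  by rewrite /lo /m' /= gK; case: (m _ _).
exists m' => z x ne; have [mz mx mm minj] := fm (lo z) (lo x) ne.
split=> //.
  rewrite [LHS]surjective_pairing [RHS]surjective_pairing.
  rewrite {1}/m' /= loE mm /=; congr pair.
  rewrite /m' /= gK /= GRing.subKr -[RHS]fK.
  by case: (f x.2).
move=> z' ne' e; have elo := congr1 lo e; rewrite !loE in elo.
have {}elo := minj (lo z') ne' elo.
have e2 := congr1 snd (can_inj gK (congr1 snd e)).
have {}e2 : (f z.2).2 = (f z'.2).2 := GRing.addIr _ e2.
case: elo => e1 e3; rewrite [z]surjective_pairing [z']surjective_pairing e1.
by congr pair; rewrite -[z.2]fK -[z'.2]fK [f z.2]surjective_pairing e3 e2 -surjective_pairing.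
Qed.

(** In odd order n+1 the number (n+2)/2 is an inverse of 2. *)
Lemma double_inj n : odd n.+1 -> injective (fun x : 'I_n.+1 => x + x)%R.
Proof.
move=> on; apply: (can_inj (g := fun x => x *+ (n.+2)./2)%R) => x.
have -> : (x + x = x *+ 2)%R by rewrite GRing.mulr2n.
rewrite -GRing.mulrnA mul2n even_halfK; last by rewrite oddS on.
rewrite GRing.mulrSr; have -> : (x *+ n.+1 = 0)%R.
  by apply: val_inj; rewrite Zp_mulrn /= modnMl.
exact: GRing.add0r.
Qed.

(** The reflection in z exchanges x and y precisely when z is their midpoint,
    and in odd order midpoints are unique. *)
Lemma frame_odd n : odd n.+1 ->
  frame (Y := unit) (U := 'I_n.+1) (fun z x => (z.1 + z.1 - x.1, tt)%R).
Proof.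
move=> /double_inj dbl [a []] [b []] /= ba; split.
- apply: contra ba => /eqP; rewrite -GRing.addrA -[X in _ = X]GRing.addr0.
  by move/GRing.addrI/eqP; rewrite GRing.subr_eq0 eq_sym.
- apply: contra ba; rewrite GRing.subr_eq eq_sym => /eqP /dbl ->.
  by rewrite eqxx.
- by rewrite GRing.subKr.
- by move=> [a' []] _ /(congr1 fst) e; have /dbl -> := GRing.addIr _ e.
Qed.

(** Octets are the elements of Z_8 in binary. The two low bits give the residue
    mod 4, so they name the coset of {0,4}. *)
Definition octet := ((bool * bool) * bool)%type.
Definition code (z : octet) : nat := z.1.1 + 2 * z.1.2 + 4 * z.2.
Definition decode (n : nat) : octet := ((odd n, odd n./2), odd n./2./2).

(** The involution 1-2, 3-6, 5-7 off {0,4}. Its differences +-1, +-3, +-2 are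
    all the residues outside {0,4}, once each, so every edge between different
    cosets of {0,4} lies in exactly one translate. *)
Definition starter (n : nat) : nat := nth 0 [:: 0; 2; 1; 6; 4; 7; 3; 5] n.
Definition rotate (z x : octet) : octet :=
  decode (code z + starter ((code x + (8 - code z)) %% 8)).

Lemma frame_four : frame rotate.
Proof.
move=> z x ne; split.
- by move: z x ne => [[[] []] []] [[[] []] []].
- by move: z x ne => [[[] []] []] [[[] []] []].
- by move: z x ne => [[[] []] []] [[[] []] []].
- by move: z x ne => [[[] []] []] [[[] []] []] // _ [[[] []] []].
Qed.

(** * The systems for k = 2 and k = 4 *)

Definition swap_infinity (Y : finType) (v : Y) (x : option Y) : option Y :=
  match x with
  | None => Some v
  | Some y => if y == v then None else Some y
  end.

(** On five points, the partition with index v is {v, infinity} and the three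
    remaining finite points. *)
Lemma system_swap (Y : finType) :
  #|Y| = 4 -> triple_pair_system (@swap_infinity Y).
Proof.
move=> cY.
have fixE v : fixpoints (@swap_infinity Y v) = Some @: [set~ v].
  apply/setP => -[y|]; rewrite inE /=; last first.
    by apply/esym/negbTE/imsetP => -[].
  rewrite mem_imset ?inE; last by move=> ? ? [].
  by case: (eqVneq y v) => [//|_]; rewrite eqxx.
split.
- by move=> v [y|] /=; [case: (eqVneq y v) => [->|/negPf] //= -> | rewrite eqxx].
- move=> v; rewrite fixE card_imset; last by move=> ? ? [].
  by apply/eqP; rewrite -(eqn_add2l 1) -{1}(cards1 v) cardsC cY.
- move=> i j [y|] /= ij; last by case=> /eqP; rewrite (negPf ij).
  by case: (eqVneq y i) => // ->; rewrite (negPf ij).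
- move=> i j [y|] /= ij; rewrite !fixE; last by move=> /imsetP [].
  by case: (y == j) => // _ /imsetP [].
- move=> i j ij; exists (Some j); rewrite fixE mem_imset ?inE // 1?eq_sym //.
  + by move=> ? ? [].
  + by rewrite eqxx.
  + by move=> ? ? [].
Qed.

(** For k = 4 write the nine points as p q r s a b x y z, numbered from 0 to 8.
    The eight partitions are
<<
    pqs ax by rz      bps rx qy az
    aqr bx sy pz      pqr ab sx yz
    aqs px ry bz      ars bq py xz
    bpr qx ay sz      brs pa qz xy
>>
    The triples are the faces of the sphere obtained from the tetrahedron pqrs
    by stacking a on the face qrs and b on the face prs. A counting argument
    suggests a closed surface: in a system for k = 4 the pairs use all but 12 of
    the 36 edges, and each point lies in as many triples as unused edges. Two
    disjoint tetrahedra satisfy the same count but fail, since a partition whose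
    triple is a face of one of them would have to match the four vertices of the
    other with the only two remaining points.

    On the sphere, the three missing edges pa, ab, bq serve as pairs in three
    partitions, together with xy, yz, xz; the fifteen other pairs between
    p q r s a b and x y z used by the remaining five, and the three left over,
    come from a 3-edge-colouring of a bipartite cubic graph with colours
    x, y, z. *)
Definition partners : seq (seq nat) :=
  [:: [:: 0; 1; 8; 3; 6; 7; 4; 5; 2];
      [:: 8; 1; 2; 7; 4; 6; 5; 3; 0];
      [:: 6; 1; 7; 3; 4; 8; 0; 2; 5];
      [:: 0; 6; 2; 8; 7; 5; 1; 4; 3];
      [:: 0; 7; 6; 3; 8; 5; 2; 1; 4];
      [:: 0; 1; 2; 6; 5; 4; 3; 8; 7];
      [:: 7; 5; 2; 3; 4; 1; 8; 0; 6];
      [:: 4; 8; 2; 3; 0; 5; 7; 6; 1]].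

Definition code_point (x : option octet) : nat := if x is Some z then code z else 8.
Definition decode_point (n : nat) : option octet :=
  if n < 8 then Some (decode n) else None.

Definition partner (i : octet) (x : option octet) : option octet :=
  decode_point (nth 0 (nth [::] partners (code i)) (code_point x)).

(** Explicit enumerations, so that the conditions on the table evaluate to
    booleans. *)
Definition octets : seq octet := [seq decode n | n <- iota 0 8].
Definition points : seq (option octet) := None :: [seq Some z | z <- octets].

Lemma mem_octets z : z \in octets.
Proof. by case: z => [[[] []] []]. Qed.

Lemma mem_points x : x \in points.
Proof. by case: x => [[[[] []] []]|]. Qed.

Lemma system_octet : triple_pair_system partner.
Proof.
have inv : all (fun i => all (fun x => partner i (partner i x) == x) points) octets.
  by vm_compute.
have fix3 : all (fun i => count (fun x => partner i x == x) points == 3) octets.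
  by vm_compute.
have pairs : all (fun i => all (fun j => (i == j) || all (fun x =>
    (partner i x == partner j x) ==> (partner i x == x)) points) octets) octets.
  by vm_compute.
have pair_triple : all (fun i => all (fun j => (i == j) || all (fun x =>
    (partner i x == x) && (partner i (partner j x) == partner j x) ==>
    (partner j x == x)) points) octets) octets.
  by vm_compute.
have triples : all (fun i => all (fun j => (i == j) || has (fun x =>
    (partner i x == x) && (partner j x != x)) points) octets) octets.
  by vm_compute.
have allO (a : pred octet) : all a octets -> forall i, a i.
  by move=> /allP h i; apply/h/mem_octets.
have allV (a : pred (option octet)) : all a points -> forall x, a x.
  by move=> /allP h x; apply/h/mem_points.
split.
- by move=> i x; apply/eqP/(allV _ (allO _ inv i)).
- move=> i; rewrite -(eqP (allO _ fix3 i)) -size_filter.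
  rewrite -(card_uniqP _); last by rewrite filter_uniq.
  by apply: eq_card => x; rewrite mem_filter mem_points andbT inE.
- move=> i j x ij e; have := allO _ (allO _ pairs i) j.
  rewrite (negPf ij) => /allV /(_ x); rewrite e eqxx => /eqP -> //.
- move=> i j x ij; have := allO _ (allO _ pair_triple i) j.
  rewrite (negPf ij) => /allV /(_ x); rewrite !inE => /implyP h fx fy.
  by apply/eqP/h/andP.
- move=> i j ij; have := allO _ (allO _ triples i) j.
  rewrite (negPf ij) => /hasP [x _ /andP [fx fy]].
  by exists x; rewrite inE.
Qed.

(** * All even k *)

Definition has_system (Y : finType) : Prop :=
  exists p : Y -> option Y -> option Y, triple_pair_system p.

Lemma has_system_prod (U Y : finType) (m : U * Y -> U * Y -> U * Y) :
  frame m -> has_system Y -> has_system (U * Y)%type.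
Proof. by move=> fm [p sp]; exists (fill m p); apply: system_fill. Qed.

Lemma has_system_odd n (Y : finType) :
  odd n -> 0 < #|Y| -> has_system Y -> has_system ('I_n * Y)%type.
Proof.
case: n => // n /frame_odd fU Y0.
have [|m fm] := frame_weight (W := Y) fU Y0; first by rewrite card_unit mul1n.
exact: has_system_prod fm.
Qed.

Lemma has_system_four (Y : finType) w :
  0 < w -> #|Y| = 2 * w -> has_system Y -> has_system ((bool * bool) * Y)%type.
Proof.
move=> w0 cY.
have [|m fm] := frame_weight (W := Y) frame_four w0; first by rewrite card_bool.
exact: has_system_prod fm.
Qed.

(** The remaining case k/4 even uses the system for k' = k/4, whose 2k' finite
    points form each of the four holes. The factor 4 cannot be replaced by 2: in
    a frame with two holes, the matched points would have to lie in different
    holes, both different from the hole of the index. *)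
Lemma exists_system k : 0 < k -> ~~ odd k ->
  exists Y : finType, #|Y| = 2 * k /\ has_system Y.
Proof.
elim/ltn_ind: k => k IH k0 /even_halfK ek.
have [om | em] := boolP (odd k./2).
  exists ('I_(k./2) * (bool * bool))%type; split.
    by rewrite !card_prod card_ord card_bool; lia.
  apply: has_system_odd => //; first by rewrite card_prod card_bool.
  by eexists; apply: system_swap; rewrite card_prod card_bool.
have ek2 := even_halfK em.
have [om' | em'] := boolP (odd k./2./2).
  exists ('I_(k./2./2) * octet)%type; split.
    by rewrite !card_prod card_ord card_bool; lia.
  apply: has_system_odd => //; first by rewrite !card_prod card_bool.
  by exists partner; apply: system_octet.
have [|||Y [cY sY]] := IH k./2./2; [lia | lia | done | ].
exists ((bool * bool) * Y)%type; split.
  by rewrite !card_prod card_bool cY; lia.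
by apply: has_system_four cY sY; lia.
Qed.

Unset Implicit Arguments.

Theorem theorem3p2 (k : nat) (hk : 2 <= k) (k_even : ~~ odd k)
    (T : finType) (X : {set T}) (hX : #|X| = 2 * k + 1) :
  exists S : {set {set {set T}}},
    sperner_kpartition_system k X S /\ #|S| = 2 * k.
Proof.
have [Y [cY [p sys_p]]] := exists_system (ltnW hk) k_even.
have cV : #|{: option Y}| = 2 * k + 1 by rewrite card_option cY addn1.
have [S [sperS cS]] := sperner_of_system sys_p cV.
have [|S' [sperS' cS']] := sperner_transfer (X := X) _ sperS.
  by rewrite cV hX.
by exists S'; rewrite cS' cS cY.
Qed.
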